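(* For all integers $r,n\ge 1$, the variable graph $G_{r,n}$ has treewidth $$\mathrm{tw}(G_{r,n})=\min(n,r+1).$$ In particular, when $r+1\le n$, there is a chordal extension of $G_{r,n}$ whose maximal clique size is at most $r+2$.
   Context: $G_{r,n}$ is the simple undirected graph with the $n(r+1)$ vertices $x_i$ ($1\le i\le n$) and $t_{l,i}$ ($1\le l\le r$, $1\le i\le n$), in which two distinct vertices are adjacent iff they appear together in one of the constraints $t_{l,1}=f_{l,1}(x_1)$, or $t_{l,i}=t_{l,i-1}f_{l,i}(x_i)$ for $2\le i\le n$, where $1\le l\le r$. Explicitly, the edges are: $t_{l,1}x_1$ for every $l$; and $t_{l,i}t_{l,i-1}$, $t_{l,i}x_i$, $t_{l,i-1}x_i$ for every $l$ and every $2\le i\le n$. A tree decomposition of a graph $G=(V,E)$ is a tree each of whose nodes carries a subset (bag) of $V$, such that the bags cover $V$, every edge of $G$ has both endpoints in some bag, and for each $v\in V$ the nodes whose bags contain $v$ form a connected subtree. Its width is the size of its largest bag minus one, and $\mathrm{tw}(G)$ is the minimum width over all tree decompositions of $G$. A graph is chordal if every cycle of length at least four has a chord; a chordal extension of $G$ is a chordal graph on the same vertex set containing all edges of $G$. *)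

(* Defs.v *)
From mathcomp Require Import all_boot.
From mathcomp Require Import boolp.

Set Implicit Arguments.
Unset Strict Implicit.
Unset Printing Implicit Defensive.

Record sgraph (V : finType) := SGraph {
  adj :> rel V;
  adj_sym : symmetric adj;
  adj_irr : irreflexive adj }.

(* [ucycle] alone also accepts [::] and the closed walk [:: x; y] along an
   edge, hence the size bound. *)
Definition graph_cycle (V : finType) (G : sgraph V) (c : seq V) : Prop :=
  ucycle G c /\ 2 < size c.

Definition is_tree (T : finType) (E : sgraph T) : Prop :=
  [/\ 0 < #|T|, forall s t, connect E s t & forall c, ~ graph_cycle E c].

Definition has_chord (V : finType) (G : sgraph V) (c : seq V) : Prop :=
  exists u v, [/\ u \in c, v \in c, G u v, next c u != v & next c v != u].

Definition chordal (V : finType) (G : sgraph V) : Prop :=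
  forall c, graph_cycle G c -> 3 < size c -> has_chord G c.

Definition chordal_extension (V : finType) (G H : sgraph V) : Prop :=
  subrel G H /\ chordal H.

Definition clique (V : finType) (G : sgraph V) (K : {set V}) : bool :=
  [forall u in K, forall v in K, (u != v) ==> G u v].

Definition clique_number (V : finType) (G : sgraph V) : nat :=
  \max_(K : {set V} | clique G K) #|K|.

Record tree_decomposition (V : finType) (G : sgraph V) (T : finType)
    (E : sgraph T) (bag : T -> {set V}) : Prop := TreeDecomposition {
  td_tree : is_tree E;
  td_vertex : forall v, exists t, v \in bag t;
  td_edge : forall u v, G u v -> exists t, (u \in bag t) && (v \in bag t);
  (* the nodes whose bags contain [v] induce a connected subgraph of [E] *)
  td_connected : forall v s t, v \in bag s -> v \in bag t ->
    connect [rel a b | [&& E a b, v \in bag a & v \in bag b]] s t }.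

(* The predecessor is truncated, so the graph without vertices gets width 0
   instead of -1. *)
Definition width (V T : finType) (bag : T -> {set V}) : nat :=
  (\max_(t : T) #|bag t|).-1.

Definition has_td_width (V : finType) (G : sgraph V) (k : nat) : Prop :=
  exists (T : finType) (E : sgraph T) (bag : T -> {set V}),
    tree_decomposition G E bag /\ width bag = k.

Definition edgeless (T : finType) : sgraph T :=
  @SGraph T (fun _ _ => false) (fun _ _ => erefl) (fun _ => erefl).

Lemma trivial_tree_decomposition (V : finType) (G : sgraph V) :
  tree_decomposition G (edgeless unit) (fun=> [set: V]).
Proof.
split=> [|v|u v _|v [] [] _ _]; last exact: connect0.
- split=> [|s t|[|x [|y c]] []]; rewrite ?card_unit //.
  by case: s; case: t; apply: connect0.
- by exists tt; rewrite inE.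
- by exists tt; rewrite !inE.
Qed.

Lemma treewidth_subproof (V : finType) (G : sgraph V) :
  exists k, `[< has_td_width G k >].
Proof.
exists (width (fun _ : unit => [set: V])); apply/asboolP.
exists unit, (edgeless unit), (fun=> [set: V]).
by split=> //; apply: trivial_tree_decomposition.
Qed.

Definition treewidth (V : finType) (G : sgraph V) : nat :=
  ex_minn (treewidth_subproof G).

Lemma treewidthP (V : finType) (G : sgraph V) (k : nat) :
  treewidth G = k <->
  has_td_width G k /\ (forall m, has_td_width G m -> k <= m).
Proof.
rewrite /treewidth; case: ex_minnP => m /asboolP Gm min_m; split=> [<-|[Gk min_k]].
  by split=> // j Gj; apply: min_m; apply/asboolP.
by apply/eqP; rewrite eqn_leq min_k // andbT; apply: min_m; apply/asboolP.
Qed.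

(* Indices start at 0: [xvar i] is x_(i+1) and [tvar l i] is t_(l+1,i+1). *)
Definition var (r n : nat) : finType := ('I_n + 'I_r * 'I_n)%type.
Definition xvar (r n : nat) (i : 'I_n) : var r n := inl i.
Definition tvar (r n : nat) (l : 'I_r) (i : 'I_n) : var r n := inr (l, i).

(* The variables of t_(l,i) = t_(l,i-1) f_(l,i)(x_i); for the first index no
   [j] qualifies, which leaves those of t_(l,1) = f_(l,1)(x_1). *)
Definition constraint_vars (r n : nat) (l : 'I_r) (i : 'I_n) : {set var r n} :=
  [set xvar r i; tvar l i] :|: [set tvar l j | j : 'I_n & j.+1 == i].

Definition var_adj (r n : nat) : rel (var r n) :=
  fun u v => (u != v) &&
    [exists l, exists i, (u \in constraint_vars l i) && (v \in constraint_vars l i)].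

Lemma var_adj_sym (r n : nat) : symmetric (@var_adj r n).
Proof.
move=> u v; rewrite /var_adj eq_sym; congr (_ && _).
by apply: eq_existsb => l; apply: eq_existsb => i; rewrite andbC.
Qed.

Lemma var_adj_irr (r n : nat) : irreflexive (@var_adj r n).
Proof. by move=> u; rewrite /var_adj eqxx. Qed.

Definition variable_graph (r n : nat) : sgraph (var r n) :=
  SGraph (@var_adj_sym r n) (@var_adj_irr r n).

Lemma variable_graph_xx (r n : nat) (i j : 'I_n) :
  variable_graph r n (xvar r i) (xvar r j) = false.
Proof.
apply/negP=> /andP[ne /existsP[l /existsP[k]]]; rewrite !inE.
case/andP=> [/orP[/orP[/eqP[ik]|/eqP//]|/imsetP[a _ //]]].
case/orP=> [/orP[/eqP[jk]|/eqP//]|/imsetP[a _ //]].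
by rewrite ik jk eqxx in ne.
Qed.

Lemma variable_graph_tx (r n : nat) (l : 'I_r) (i j : 'I_n) :
  variable_graph r n (tvar l i) (xvar r j) = (i == j) || (i.+1 == j).
Proof.
apply/andP/orP => [[_ /existsP[l' /existsP[k]]]|H].
  rewrite !inE => /andP[Ht].
  case/orP=> [/orP[/eqP[->]|/eqP//]|/imsetP[b _ //]].
  case/orP: Ht => [/orP[/eqP//|/eqP[_ ->]]|/imsetP[a ak [_ ->]]]; first by left.
  by right; rewrite inE in ak.
split=> //; apply/existsP; exists l; apply/existsP; exists j.
rewrite !inE eqxx /= andbT; case: H => [/eqP->|H]; first by rewrite eqxx.
by apply/orP; right; apply/imsetP; exists i; rewrite ?inE.
Qed.

Lemma variable_graph_tt (r n : nat) (l m : 'I_r) (i j : 'I_n) :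
  variable_graph r n (tvar l i) (tvar m j) =
    (l == m) && ((i.+1 == j) || (j.+1 == i)).
Proof.
have step (k : 'I_r) (a b : 'I_n) : a.+1 == b ->
    variable_graph r n (tvar k a) (tvar k b).
  move=> ab; apply/andP; split.
    by apply/eqP=> -[eab]; rewrite eab (gtn_eqF (ltnSn b)) in ab.
  apply/existsP; exists k; apply/existsP; exists b; rewrite !inE eqxx orbT andbT.
  by apply/orP; right; apply/imsetP; exists a; rewrite ?inE.
apply/idP/andP => [|[/eqP<- /orP[/step//|/step]]]; last by rewrite adj_sym.
case/andP=> ne /existsP[p /existsP[k]]; rewrite !inE => /andP[Ht Hm].
case/orP: Ht => [/orP[/eqP//|/eqP[el ei]]|/imsetP[a + [el ei]]];
  case/orP: Hm => [/orP[/eqP//|/eqP[em ej]]|/imsetP[b + [em ej]]]; subst.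
- by rewrite eqxx in ne.
- by rewrite inE => ->; rewrite eqxx orbT.
- by rewrite inE => ->; rewrite eqxx.
- rewrite !inE => /eqP bk /eqP ak; have /val_inj ab : a = b :> nat.
    by apply: succn_inj; rewrite ak bk.
  by rewrite ab eqxx in ne.
Qed.

(* Main.v *)
Require Import Defs.
From mathcomp Require Import boolp zify.
From mathcomp Require Import all_boot.

(* Upper bounds.  Sweeping the constraints column by column, each t_(l,i) enters
   the bag just before t_(l,i-1) leaves it; this path decomposition has bags of
   size at most r + 2, and its interval graph is the chordal extension.
   Removing x_2, ..., x_n leaves a spider with centre x_1, so adding these
   vertices to the bags of its decomposition gives width n.
   Lower bound.  Some bag of any tree decomposition meets every member of a given
   family of connected, pairwise touching sets, and we exhibit such a family that
   no set of min(n, r+1) vertices meets entirely. *)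

Set Implicit Arguments.
Unset Strict Implicit.
Unset Printing Implicit Defensive.

(** * Connected vertex sets and brambles *)

Lemma meetP (T : finType) (A B : {set T}) :
  reflect (exists2 x, x \in A & x \in B) (~~ [disjoint A & B]).
Proof.
rewrite -setI_eq0; apply: (iffP (set0Pn _)) => [[x]|[x xA xB]].
  by rewrite inE => /andP[]; exists x.
by exists x; rewrite inE xA.
Qed.

Definition restrict (V : finType) (G : sgraph V) (A : {set V}) : rel V :=
  [rel u v | [&& G u v, u \in A & v \in A]].

Lemma restrict_sym (V : finType) (G : sgraph V) (A : {set V}) :
  connect_sym (restrict G A).
Proof.
by apply: sym_connect_sym => u v; rewrite /restrict /= adj_sym; congr (_ && _); rewrite andbC.
Qed.

Lemma restrictS (V : finType) (G : sgraph V) (A B : {set V}) :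
  A \subset B -> subrel (restrict G A) (restrict G B).
Proof. by move=> /subsetP AB u v /and3P[uv /AB uB /AB vB]; apply/and3P. Qed.

Definition connected_in (V : finType) (G : sgraph V) (A : {set V}) : Prop :=
  {in A &, forall u v, connect (restrict G A) u v}.

Lemma connected_in_hub (V : finType) (G : sgraph V) (A : {set V}) (h : V) :
  {in A, forall u, connect (restrict G A) h u} -> connected_in G A.
Proof.
move=> Ah u v uA vA; apply: connect_trans (Ah v vA).
by rewrite restrict_sym; apply: Ah.
Qed.

Definition touching (V : finType) (G : sgraph V) (A B : {set V}) : Prop :=
  exists u v, [/\ u \in A, v \in B & (u == v) || G u v].

Record bramble (V : finType) (G : sgraph V) (P : {set V} -> Prop) : Prop :=
  Bramble {
    bramble_connected : forall A, P A -> connected_in G A;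
    bramble_touching : forall A B, P A -> P B -> touching G A B }.

(** * Separation and backtracking in trees *)

(** A walk from [b] to [s] avoiding [a] and one from [a] to [s] avoiding [b] both miss the edge
    between [a] and [b], so together with it they would close a cycle. *)
Lemma tree_edge_cut (T : finType) (E : sgraph T) (a b s : T) :
  is_tree E -> E a b -> connect (restrict E [set~ a]) b s ->
  ~~ connect (restrict E [set~ b]) a s.
Proof.
case=> _ _ acyc ab bs; apply/negP => aS.
pose F := [rel u v | E u v && ([set u; v] != [set a; b])].
have subF c : c \in [set a; b] ->
    subrel (connect (restrict E [set~ c])) (connect F).
  move=> cab; apply: connect_sub => u v /and3P[uv uc vc]; apply: connect1.
  rewrite /= uv /=; apply: contraL cab => /eqP<-.
  by move: uc vc; rewrite !inE negb_or => uc vc; rewrite eq_sym uc eq_sym vc.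
have Fsym : connect_sym F.
  by apply: sym_connect_sym => u v; rewrite /= adj_sym setUC.
have: connect F a b.
  apply: (@connect_trans _ _ s); first by apply: (subF b); rewrite ?inE ?eqxx ?orbT.
  by rewrite Fsym; apply: (subF a); rewrite ?inE ?eqxx.
case/connectP=> p Fp; case: (shortenP Fp) => q Fq uq _ lastq.
apply: (acyc (a :: q)); split; first (apply/andP; split=> //).
  rewrite /= rcons_path -lastq adj_sym ab andbT.
  by apply: sub_path Fq => u v /andP[].
(* An empty path would give [a = b], and a single edge would be the one removed in [F]; hence the
   cycle has length at least three. *)
case: q Fq uq lastq => [|x [|y q]] //=.
  by move=> _ _ eab; rewrite eab adj_irr in ab.
by move=> /andP[/andP[_ +] _] _ ebx; rewrite ebx eqxx.
Qed.

(** On a simple path from [a] to [s], everything after the first step avoids [a]. *)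
Lemma connect_toward (T : finType) (E : sgraph T) (a s : T) :
  connect E a s -> a != s ->
  exists2 b, E a b & connect (restrict E [set~ a]) b s.
Proof.
case/connectP=> p Ep; case: (shortenP Ep) => q Eq uq _ -> {p Ep}.
case: q Eq uq => [|b q] /=; first by rewrite eqxx.
case/andP=> ab bq /andP[aq _] _; exists b => //; apply/connectP; exists q => //.
elim: q b bq aq {ab} => //= c q IH b /andP[bc cq]; rewrite !inE !negb_or.
case/and3P=> ab ac aq.
by rewrite {1}/restrict /= bc !inE eq_sym ab eq_sym ac IH // !inE negb_or ac.
Qed.

(** The orbit of a periodic point of [g] is a closed walk through distinct nodes; irreflexivity
    excludes length one and acyclicity length three or more. *)
Lemma tree_backtrack (T : finType) (E : sgraph T) (g : T -> T) :
  is_tree E -> (forall t, E t (g t)) -> exists t, g (g t) = t.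
Proof.
move=> [/card_gt0P[t0 _] _ acyc] Eg; apply: contrapT => nog.
(* A point with smallest orbit is periodic: the orbit of its image lies inside its own and cannot be
   smaller. *)
case: (arg_minnP (order g) (erefl (xpredT t0))) => x _ minx.
have eqo : order g (g x) = order g x.
  apply/eqP; rewrite eqn_leq minx // andbT; apply: subset_leq_card.
  by apply/subsetP=> y; rewrite !inE; apply: connect_trans (fconnect1 g x).
have cyc : fcycle g (orbit g x) by apply/(orbitPcycle 1 0).
apply: (acyc (orbit g x)); split.
  apply/andP; split; last exact: orbit_uniq.
  by apply: sub_cycle cyc => u v /eqP <-.
have itx : iter (order g x) g x = x by apply/(orbitPcycle 0 4).
rewrite size_orbit; case: (order g x) (order_gt0 g x) itx => [|[|[|k]]] //= _ itx.
  by have := Eg x; rewrite itx adj_irr.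
by case: nog; exists x.
Qed.

(** * Bags meeting a connected set, and bags covering a bramble *)

(** Along a path inside [A], the nodes of each vertex are connected and consecutive vertices share a
    bag. *)
Lemma bag_trace_connected (V T : finType) (G : sgraph V) (E : sgraph T)
    (bag : T -> {set V}) (A : {set V}) (u v : V) (s t : T) :
  tree_decomposition G E bag -> connected_in G A -> u \in A -> v \in A ->
  u \in bag s -> v \in bag t ->
  connect (restrict E [set c | ~~ [disjoint bag c & A]]) s t.
Proof.
move=> td conA uA vA us vt; set S := [set c | _].
have step w c d : w \in A -> w \in bag c -> w \in bag d -> connect (restrict E S) c d.
  move=> wA wc wd; apply: connect_sub (td_connected td wc wd) => a b.
  move=> /and3P[ab wa wb]; apply: connect1; rewrite /restrict /= !inE.
  by apply/and3P; split=> //; apply/meetP; exists w.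
have /connectP[p] := conA u v uA vA.
elim: p u uA s us => [|w p IH] u uA s us /= => [_ euv|].
  by apply: (step v) => //; rewrite euv.
case/andP=> /and3P[uw _ wA] pw lastp.
have [c /andP[uc wc]] := td_edge td uw.
by apply: connect_trans (step u s c uA us uc) (IH w wA c wc pw lastp).
Qed.

(* Otherwise walk from each node towards the trace of a bramble element that
   its bag misses; since the walk cannot cycle it backtracks across some tree
   edge [a b], which then separates two touching elements. *)
Lemma bramble_cover (V T : finType) (G : sgraph V) (E : sgraph T)
    (bag : T -> {set V}) (P : {set V} -> Prop) :
  tree_decomposition G E bag -> bramble G P ->
  exists t, forall A, P A -> ~~ [disjoint bag t & A].
Proof.
move=> td [conP touP]; have [_ Econ _] := td_tree td.
apply: contrapT => noT.
have /choice[f fP] : forall t, exists A, P A /\ [disjoint bag t & A].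
  move=> t; apply: contrapT => nof; case: noT; exists t => A PA.
  by apply/negP => dA; apply: nof; exists A.
pose S (A : {set V}) := [set t | ~~ [disjoint bag t & A]].
have SP (A : {set V}) v s : v \in A -> v \in bag s -> s \in S A.
  by move=> vA vs; rewrite inE; apply/meetP; exists v.
have /choice[g gP] : forall t, exists b, E t b /\
    forall s, s \in S (f t) -> connect (restrict E [set~ t]) b s.
  move=> t; have [Pt dt] := fP t.
  have [v [_ [vA _ _]]] := touP _ _ Pt Pt.
  have [s vs] := td_vertex td v.
  have sS : s \in S (f t) by apply: SP vA vs.
  have ts : t != s by apply: contraTneq sS => <-; rewrite inE dt.
  have [b tb bs] := connect_toward (Econ t s) ts.
  exists b; split=> // s'; rewrite inE => /meetP[v' v's' v'A].
  apply: connect_trans bs _.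
  apply: connect_sub (bag_trace_connected td (conP _ Pt) vA v'A vs v's').
  move=> c d cd; apply: connect1; apply: restrictS cd; apply/subsetP => c'.
  by rewrite !inE; apply: contraNneq => ->.
have [a ga] := tree_backtrack (td_tree td) (fun t => (gP t).1).
have [ab aP] := gP a; have [_ bP] := gP (g a); rewrite ga in bP.
have [u [v [uA vB uv]]] := touP _ _ (fP a).1 (fP (g a)).1.
have [s us vs] : exists2 s, u \in bag s & v \in bag s.
  case/orP: uv => [/eqP->|/(td_edge td)[s /andP[]]]; last by exists s.
  by have [s vs] := td_vertex td v; exists s.
have := tree_edge_cut (td_tree td) ab (aP s (SP _ _ _ uA us)).
by rewrite (bP s (SP _ _ _ vB vs)).
Qed.

(** * Criteria for upper and lower bounds on treewidth *)

Lemma treewidth_le (V T : finType) (G : sgraph V) (E : sgraph T)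
    (bag : T -> {set V}) (k : nat) :
  tree_decomposition G E bag -> (forall t, #|bag t| <= k.+1) -> treewidth G <= k.
Proof.
move=> td small; have [_ minG] := (treewidthP G _).1 erefl.
apply: leq_trans (minG (width bag) _) _; first by exists T, E, bag.
have : \max_t #|bag t| <= k.+1 by apply/bigmax_leqP => t _.
by rewrite /width; lia.
Qed.

Lemma leq_treewidth (V : finType) (G : sgraph V) (P : {set V} -> Prop) (k : nat) :
  bramble G P ->
  (forall X : {set V}, #|X| <= k -> exists2 A, P A & [disjoint X & A]) ->
  k <= treewidth G.
Proof.
move=> brP missed; have [[T [E [bag [td <-]]]] _] := (treewidthP G _).1 erefl.
have [t tP] := bramble_cover td brP.
have : k < #|bag t|.
  by rewrite ltnNge; apply/negP => /missed[A /tP/negP].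
have := leq_bigmax (F := fun t => #|bag t|) t; rewrite /width; lia.
Qed.

(** * Neighbours along a cycle *)

Lemma next_neq_prev (V : eqType) (c : seq V) (x : V) :
  uniq c -> 2 < size c -> x \in c -> next c x != prev c x.
Proof.
(* Once the cycle is rotated to start at [x], [next] is its second entry and [prev] its last. *)
move=> uc sc xc; have [i p rotc] := rot_to xc.
rewrite -(next_rot i uc) -(prev_rot i uc) rotc next_nth prev_nth mem_head /= eqxx.
move: uc sc; rewrite -(rot_uniq i) -(size_rot i) rotc cons_uniq => /andP[xp].
rewrite (memNindex xp); case: p {rotc xp} => [|y [|z p]] //= /andP[+ _] _.
apply: contraNneq => ->.
by rewrite -[size p]/(size (z :: p)).-1 nth_last /= mem_last.
Qed.

Lemma cycle_neighbours (V : finType) (G : sgraph V) (c : seq V) (x : V) :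
  graph_cycle G c -> x \in c -> G x (next c x) /\ G x (prev c x).
Proof.
move=> [/andP[cc _] _] xc; split; first exact: next_cycle.
by rewrite adj_sym prev_cycle.
Qed.

(** Ensures that an edge joining the two cycle neighbours of [x] is a chord and not a third side of
    a triangle. *)
Lemma next_next_neq_prev (V : eqType) (c : seq V) (x : V) :
  uniq c -> 3 < size c -> x \in c -> next c (next c x) != prev c x.
Proof.
move=> uc sc xc; have [i p rotc] := rot_to xc.
rewrite -!(next_rot i uc) -(prev_rot i uc) rotc !next_nth prev_nth !mem_head /= eqxx.
move: uc sc; rewrite -(rot_uniq i) -(size_rot i) rotc cons_uniq => /andP[xp].
rewrite (memNindex xp); case: p {rotc} xp => [|y [|z [|w p]]] //=.
rewrite !inE negb_or => /andP[/negPf xy _] /and3P[_ + _] _.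
rewrite eqxx orbT xy /=; apply: contraNneq => ->.
by rewrite -[size p]/(size (w :: p)).-1 nth_last /= -in_cons mem_last.
Qed.

(** * Trees given by a parent function *)

Section ParentTree.
Variables (T : finType) (parent : T -> T).

Definition parent_adj : rel T :=
  fun s t => (s != t) && ((parent s == t) || (parent t == s)).

Lemma parent_adj_sym : symmetric parent_adj.
Proof. by move=> s t; rewrite /parent_adj eq_sym orbC. Qed.

Lemma parent_adj_irr : irreflexive parent_adj.
Proof. by move=> s; rewrite /parent_adj eqxx. Qed.

Definition parent_graph : sgraph T := SGraph parent_adj_sym parent_adj_irr.

Variables (root : T) (depth : T -> nat).
Hypothesis parent_root : parent root = root.
Hypothesis parent_depth : forall t, t != root -> depth (parent t) < depth t.

(** A deepest vertex of a cycle could only have its parent as cycle neighbour, yet it has two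
    distinct ones. *)
Lemma parent_graph_cycle c : ~ graph_cycle parent_graph c.
Proof.
move=> cyc; have [/andP[_ uc] sc] := cyc.
have [x0 x0c] : exists x0, x0 \in c.
  by case: c sc {cyc uc} => // x c _; exists x; rewrite mem_head.
case: (arg_maxnP depth x0c) => x xc maxx.
suff up y : y \in c -> parent_adj x y -> parent x = y.
  have [xn xp] := cycle_neighbours cyc xc.
  have := next_neq_prev uc sc xc.
  by rewrite -(up _ _ xn) ?mem_next // (up _ _ xp) ?mem_prev // eqxx.
move=> yc /andP[xy /orP[/eqP//|/eqP yx]].
have [yr|/parent_depth] := eqVneq y root.
  by rewrite -yx yr parent_root eqxx in xy.
by rewrite yx ltnNge; have /= -> := maxx _ yc.
Qed.

Lemma parent_graph_tree : is_tree parent_graph.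
Proof.
split; first by apply/card_gt0P; exists root.
  have up t : connect parent_graph t root.
    elim: {t}_.+1 {-2}t (ltnSn (depth t)) => // k IH t tk.
    have [->|tr] := eqVneq t root; first exact: connect0.
    have lt := parent_depth tr.
    apply: (@connect_trans _ _ (parent t)); last exact/IH/(leq_trans lt).
    apply/connect1/andP; rewrite eqxx; split=> //.
    by apply: contraTneq lt => <-; rewrite ltnn.
  move=> s t; apply: connect_trans (up s) _.
  by rewrite (sym_connect_sym parent_adj_sym).
exact: parent_graph_cycle.
Qed.

(** Climbing from any node whose bag contains [v] stays among such nodes until [top v], so they are
    all connected through [top v]. *)
Lemma parent_tree_decomposition (V : finType) (G : sgraph V)
    (bag : T -> {set V}) (top : V -> T) :
  (forall v, v \in bag (top v)) ->
  (forall v t, v \in bag t -> t != top v -> (t != root) && (v \in bag (parent t))) ->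
  (forall u v, G u v -> exists t, (u \in bag t) && (v \in bag t)) ->
  tree_decomposition G parent_graph bag.
Proof.
move=> topP upP edgeP; split=> //; first exact: parent_graph_tree.
  by move=> v; exists (top v).
move=> v s t vs vt; set R := [rel a b | _].
have Rsym : connect_sym R.
  apply: sym_connect_sym => a b; rewrite /= parent_adj_sym; congr (_ && _).
  exact: andbC.
have up a : v \in bag a -> connect R a (top v).
  elim: {a}_.+1 {-2}a (ltnSn (depth a)) => // k IH a ak va.
  have [->|at'] := eqVneq a (top v); first exact: connect0.
  have /andP[ar vp] := upP _ _ va at'; have lt := parent_depth ar.
  apply: (@connect_trans _ _ (parent a)); last exact/IH/vp/(leq_trans lt).
  apply/connect1; rewrite /= va vp /parent_adj eqxx !andbT /=.
  by apply: contraTneq lt => <-; rewrite ltnn.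
by apply: connect_trans (up s vs) _; rewrite Rsym up.
Qed.

End ParentTree.

(** * Interval graphs and their path decompositions *)

Section IntervalGraph.
Variables (V : finType) (lo hi : V -> nat).

Definition interval_adj : rel V :=
  fun u v => [&& u != v, lo u <= hi v & lo v <= hi u].

Lemma interval_adj_sym : symmetric interval_adj.
Proof. by move=> u v; rewrite /interval_adj eq_sym; congr (_ && _); rewrite andbC. Qed.

Lemma interval_adj_irr : irreflexive interval_adj.
Proof. by move=> u; rewrite /interval_adj eqxx. Qed.

Definition interval_graph : sgraph V := SGraph interval_adj_sym interval_adj_irr.

Definition interval_bag (p : nat) : {set V} := [set v | lo v <= p <= hi v].

(* The two cycle neighbours of the vertex whose interval ends first both
   contain that end point. *)
Lemma interval_graph_chordal : chordal interval_graph.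
Proof.
move=> c cyc sc; have [/andP[_ uc] sc2] := cyc.
have [x0 x0c] : exists x0, x0 \in c.
  by case: c sc {cyc uc sc2} => // x c _; exists x; rewrite mem_head.
case: (arg_minnP hi x0c) => x xc minx.
have [xn xp] := cycle_neighbours cyc xc.
have nc : next c x \in c by rewrite mem_next.
have pc : prev c x \in c by rewrite mem_prev.
exists (next c x), (prev c x); split=> //.
- case/and3P: xn => _ _ nx; case/and3P: xp => _ _ px.
  apply/and3P; split; first exact: next_neq_prev.
    exact: leq_trans nx (minx _ pc).
  exact: leq_trans px (minx _ nc).
- exact: next_next_neq_prev.
- by rewrite next_prev //; case/andP: xn.
Qed.

Hypothesis lo_hi : forall v, lo v <= hi v.

(** Helly property of intervals: all members of a clique contain the least right end among them, so
    the clique lies in one bag. *)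
Lemma interval_clique_number (k : nat) :
  (forall p, #|interval_bag p| <= k) -> clique_number interval_graph <= k.
Proof.
move=> small; apply/bigmax_leqP => K cK.
have [->|/set0Pn[x0 x0K]] := eqVneq K set0; first by rewrite cards0.
case: (arg_minnP hi x0K) => x xK minx.
apply: leq_trans (small (hi x)); apply/subset_leq_card/subsetP => y yK.
rewrite inE minx // andbT; have [<-|yx] := eqVneq y x; first exact: lo_hi.
by have /forall_inP/(_ _ yK)/forall_inP/(_ _ xK)/implyP/(_ yx)/and3P[] := cK.
Qed.

(** The tree is the path of positions below [N] rooted at 0, with [v] first appearing at [lo v];
    cutting off later positions loses no left end. *)
Lemma interval_tree_decomposition (G : sgraph V) (N : nat) :
  (forall v, lo v < N) -> 0 < N -> subrel G interval_graph ->
  exists (T : finType) (E : sgraph T) (f : T -> nat),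
    tree_decomposition G E (interval_bag \o f).
Proof.
case: N => // N loN _ GH.
(* The truncated predecessor makes position 0 its own parent. *)
pose pa (t : 'I_N.+1) : 'I_N.+1 := inord t.-1.
have paE t : pa t = t.-1 :> nat by rewrite inordK // (leq_ltn_trans (leq_pred t)).
exists 'I_N.+1, (parent_graph pa), val.
apply: (@parent_tree_decomposition _ pa ord0 val _ _ _ _ _ (fun v => Ordinal (loN v))).
- by apply: val_inj; rewrite /= paE.
- by move=> t; rewrite -val_eqE /= paE; case: (val t).
- by move=> v; rewrite inE /= leqnn lo_hi.
- by move=> v t; rewrite !inE -!val_eqE /= paE; lia.
- move=> u v /GH/and3P[_ uv vu].
  (* Overlapping intervals both contain the larger of their left ends. *)
  exists (if lo u <= lo v then Ordinal (loN v) else Ordinal (loN u)).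
  by rewrite !inE; have := lo_hi u; have := lo_hi v; case: ifP => /=; lia.
Qed.

End IntervalGraph.

(** * The column by column sweep *)

Section Sweep.
Variables (r n : nat).
Hypothesis r_gt0 : 0 < r.

(* Position [i * r + l] of the sweep is the constraint with indices l, i; the
   intervals of the last column run past the last position. *)
Definition sweep_lo (v : var r n) : nat :=
  match v with inl i => i * r | inr (l, i) => i * r + l end.

Definition sweep_hi (v : var r n) : nat :=
  match v with inl i => i * r + r.-1 | inr (l, i) => i * r + r + l end.

Lemma sweep_lo_hi v : sweep_lo v <= sweep_hi v.
Proof. by case: v => [i|[l i]] /=; lia. Qed.

(** The interval of a t variable ends exactly where the next one in its row begins, and this
    position lies in the block of the next column's x variable. *)
Lemma sweep_edge : subrel (variable_graph r n) (interval_graph sweep_lo sweep_hi).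
Proof.
have tx l i j : variable_graph r n (tvar l i) (xvar r j) ->
    interval_graph sweep_lo sweep_hi (tvar l i) (xvar r j).
  rewrite variable_graph_tx => ij; apply/and3P; split=> //=;
    have := ltn_ord l; case/orP: ij => /eqP; [move=> ->|move=> <-|move=> ->|move=> <-]; nia.
case=> [i|[l i]] [j|[m j]].
- by rewrite variable_graph_xx.
- by rewrite adj_sym => /tx; rewrite (adj_sym (interval_graph _ _)).
- exact: tx.
- move=> tt; apply/and3P; split; first by case/andP: tt.
    all: move: tt; rewrite variable_graph_tt => /andP[/eqP lm ij].
    by rewrite /= lm; case/orP: ij => /eqP <-; nia.
  by rewrite /= lm; case/orP: ij => /eqP <-; nia.
Qed.

(** The blocks of the x variables are disjoint, so a bag holds at most one of them. The t intervals
    through [p] start between [p - r] and [p], and the start determines [l] and [i] on division by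
    [r]. *)
Lemma sweep_bag_card p : #|interval_bag sweep_lo sweep_hi p| <= r.+2.
Proof.
(* Within the bag, shifted starts take the codes 0 to [r]; the code [r + 1] is left for the x
   variable. *)
pose code (v : var r n) : 'I_r.+2 :=
  match v with inl _ => ord_max | inr (l, i) => inord (i * r + l + r - p) end.
rewrite -[r.+2]card_ord; apply: (@leq_card_in _ _ code) => u v.
have tcode l i : inr (l, i) \in interval_bag sweep_lo sweep_hi p ->
    code (inr (l, i)) = i * r + l + r - p :> nat /\ p <= i * r + l + r <= p + r.
  by rewrite inE /= => ip; rewrite inordK; lia.
case: u v => [i|[l i]] [j|[m j]].
- rewrite !inE /= => ip jp _; congr inl; apply: val_inj => /=.
  by have : i = j :> nat by nia.
- by move=> _ /tcode[cj jp] /(congr1 val); rewrite /= in cj *; rewrite cj; lia.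
- by move=> /tcode[ci ip] _ /(congr1 val); rewrite /= in ci *; rewrite ci; lia.
- move=> /tcode[ci ip] /tcode[cj jp] eqc.
  have eqp : i * r + l = j * r + m by move: ci; rewrite eqc cj; lia.
  have /val_inj -> : i = j :> nat.
    by have := congr1 (divn^~ r) eqp; rewrite !divnMDl // !divn_small // !addn0.
  have /val_inj -> // : l = m :> nat.
  by have := congr1 (modn^~ r) eqp; rewrite !modnMDl !modn_small.
Qed.

End Sweep.

(** * The spider decomposition *)

Section Spider.
Variables (r n : nat).

(** [None] is the centre and [Some (l, i)] runs along leg [l]; the default of [insubd] never occurs,
    as [i.-1] is in range. *)
Definition spider_parent (t : option ('I_r * 'I_n)) : option ('I_r * 'I_n) :=
  if t is Some (l, i) then
    if i == 0 :> nat then None else Some (l, insubd i i.-1)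
  else None.

Definition spider_depth (t : option ('I_r * 'I_n)) : nat :=
  if t is Some (_, i) then i.+1 else 0.

(** Along a leg, the x variable of index 0 leaves at the step where the bag starts to hold two t
    variables, which keeps the size at most [n + 1]. *)
Definition spider_bag (t : option ('I_r * 'I_n)) : {set var r n} :=
  [set v : var r n | match t, v with
    | None, inl _ => true
    | None, inr _ => false
    | Some (l, i), inl j => (0 < j) || (i == 0 :> nat)
    | Some (l, i), inr (m, a) => (m == l) && ((a == i) || (a.+1 == i))
    end].

Definition spider_top (v : var r n) : option ('I_r * 'I_n) :=
  if v is inr (l, i) then Some (l, i) else None.

Lemma val_pred_ord (i : 'I_n) : insubd i i.-1 = i.-1 :> nat.
Proof. by rewrite val_insubd (leq_ltn_trans (leq_pred i)). Qed.

Lemma spider_tree_decomposition :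
  tree_decomposition (variable_graph r n) (parent_graph spider_parent) spider_bag.
Proof.
apply: (@parent_tree_decomposition _ spider_parent None spider_depth _ _ _ _ _
  spider_top) => //.
- case=> [[l i]|] //= _; case: eqP => //= i0.
  by rewrite val_pred_ord; lia.
- by case=> [i|[l i]]; rewrite inE //= !eqxx.
- case=> [j|[m a]] [[l i]|]; rewrite !inE //=.
    by move=> ij _; case: (posnP i) => //= i0; rewrite val_pred_ord; lia.
  case/andP=> /eqP-> /orP[/eqP->|/eqP ai]; first by rewrite eqxx.
  move=> _; rewrite -{1}ai /= eqxx /=; apply/orP; left; apply/eqP/val_inj.
  by rewrite /= val_pred_ord -ai.
have tx l i j : variable_graph r n (tvar l i) (xvar r j) ->
    (tvar l i \in spider_bag (Some (l, i))) && (xvar r j \in spider_bag (Some (l, i))).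
  rewrite variable_graph_tx !inE /= !eqxx /=; case/orP=> /eqP => [->|<-] //.
  by case: (posnP j).
case=> [i|[l i]] [j|[m j]].
- by rewrite variable_graph_xx.
- by rewrite adj_sym => /tx; exists (Some (m, j)); rewrite andbC.
- by move/tx; exists (Some (l, i)).
- rewrite variable_graph_tt => /andP[/eqP-> /orP[ij|ji]].
    by exists (Some (m, j)); rewrite !inE /= !eqxx ij /= orbT.
  by exists (Some (m, i)); rewrite !inE /= !eqxx ji /= orbT.
Qed.

Lemma spider_bag_card t : #|spider_bag t| <= n.+1.
Proof.
(* Past the first node of a leg, code 0 is free of its x variable and serves the earlier t
   variable. *)
pose code (v : var r n) : 'I_n.+1 :=
  match t, v with
  | _, inl j => widen_ord (leqnSn n) j
  | Some (_, i), inr (_, a) => if a == i then ord_max else ord0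
  | None, inr _ => ord0
  end.
rewrite -[n.+1]card_ord; apply: (@leq_card_in _ _ code) => u v.
rewrite /code; case: t {code} => [[l i]|]; case: u v => [j|[m a]] [k|[q b]];
  rewrite !inE //.
- by move=> _ _ /(congr1 val) /= /val_inj ->.
- move=> jp /andP[_ bi] /(congr1 val) /=; case: ifP bi => /= [_ _|_ /eqP bi] ej.
    by have := ltn_ord j; rewrite ej ltnn.
  by move: jp; rewrite ej -bi.
- move=> /andP[_ bi] jp /(congr1 val) /=; case: ifP bi => /= [_ _|_ /eqP bi] ej.
    by have := ltn_ord k; rewrite -ej ltnn.
  by move: jp; rewrite -ej -bi.
- case/andP=> /eqP-> ai /andP[/eqP-> bi] /(congr1 val) /=.
  have npos := leq_ltn_trans (leq0n i) (ltn_ord i).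
  case: eqP ai => [-> _|_ /= /eqP ai]; case: eqP bi => [-> _|_ /= /eqP bi] //=; try lia.
  by move=> _; congr (inr (_, _)); apply/val_inj/succn_inj; rewrite ai bi.
- by move=> _ _ /(congr1 val) /= /val_inj ->.
Qed.

End Spider.

(** * Preliminaries to the lower bound *)

(** Serves the case [n = 1], where the bramble lacks its second column. *)
Lemma treewidth_gt0 (V : finType) (G : sgraph V) (u v : V) :
  G u v -> 0 < treewidth G.
Proof.
move=> uv; have [[T [E [bag [td <-]]]] _] := (treewidthP G _).1 erefl.
have [t /andP[ut vt]] := td_edge td uv.
have : 1 < #|bag t|.
  rewrite (cardD1 u) (cardD1 v) !inE ut vt /= andbT.
  by case: eqP uv => // ->; rewrite adj_irr.
have := leq_bigmax (F := fun t => #|bag t|) t; rewrite /width; lia.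
Qed.

Lemma connected_in1 (V : finType) (G : sgraph V) (x : V) : connected_in G [set x].
Proof. by move=> u v /set1P-> /set1P->; apply: connect0. Qed.

Lemma connected_inU1 (V : finType) (G : sgraph V) (A : {set V}) (x y : V) :
  connected_in G A -> y \in A -> G x y -> connected_in G (x |: A).
Proof.
move=> cA yA xy; apply: (@connected_in_hub _ _ _ x) => u /setU1P[->|uA].
  exact: connect0.
apply: (@connect_trans _ _ y); first by apply/connect1/and3P; rewrite !inE eqxx yA orbT.
apply: connect_sub (cA _ _ yA uA) => a b ab; apply/connect1/(restrictS _ ab).
exact: subsetUr.
Qed.

Lemma touching_sym (V : finType) (G : sgraph V) (A B : {set V}) :
  touching G A B -> touching G B A.
Proof. by case=> u [v [uA vB uv]]; exists v, u; rewrite eq_sym adj_sym. Qed.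

(** * The bramble of the variable graph *)

Section GridBramble.
Variables (r n : nat).

Definition row (l : 'I_r) : {set var r n} := [set tvar l i | i : 'I_n].

Lemma mem_row l i : tvar l i \in row l.
Proof. exact: imset_f. Qed.

Lemma row_connected l : connected_in (variable_graph r n) (row l).
Proof.
have step (i : 'I_n) : forall j : 'I_n, j <= i ->
    connect (restrict (variable_graph r n) (row l)) (tvar l j) (tvar l i).
  case: i; elim=> [|i IH] lti j /=.
    by rewrite leqn0 => /eqP j0; rewrite (_ : j = Ordinal lti) ?connect0 //; apply: val_inj.
  rewrite leq_eqVlt => /orP[/eqP ji|ji].
    by rewrite (_ : j = Ordinal lti) ?connect0 //; apply: val_inj.
  apply: connect_trans (IH (ltnW lti) j ji) _; apply/connect1/and3P.
  by rewrite !mem_row variable_graph_tt !eqxx.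
move=> _ _ /imsetP[i _ ->] /imsetP[j _ ->].
by have [ij|/ltnW ji] := leqP i j; [|rewrite restrict_sym]; apply: step.
Qed.

Lemma row_touching (A B : {set var r n}) l :
  row l \subset A ->
  (exists j, xvar r j \in B) \/ (exists j, tvar l j \in B) ->
  touching (variable_graph r n) A B.
Proof.
move=> /subsetP lA [] [j jB].
  exists (tvar l j), (xvar r j); rewrite lA ?mem_row //.
  by rewrite variable_graph_tx eqxx.
by exists (tvar l j), (tvar l j); rewrite lA ?mem_row ?eqxx.
Qed.

Variables (l0 : 'I_r) (i0 i1 : 'I_n).
Hypotheses (i0E : i0 = 0 :> nat) (i1E : i1 = 1 :> nat).

Definition beyond : {set var r n} :=
  [set v : var r n | match v with inl j => j == 2 :> nat | inr (_, i) => i == i1 end].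

(* [xvar r i1] touches every other element, so a cover avoiding it fails and
   one containing it has one vertex less for the rest.  What is left of a
   cover of size [r.+1] meeting every row is one vertex per row; such a cover
   misses a corner unless it contains the whole first column, and then it
   misses [beyond]. *)
Inductive probe : {set var r n} -> Prop :=
  | ProbeHub : probe [set xvar r i1]
  | ProbeRow : probe (row l0)
  | ProbeCross l j : probe (xvar r j |: row l)
  | ProbeCorner l : probe [set xvar r i0; tvar l i0]
  | ProbeBeyond : r < n -> probe beyond.

(** The x variable of index 2 is adjacent to the whole second column of t variables. If it does not
    exist then [n = 2], and [r < n] leaves a single row, hence a single vertex. *)
Lemma beyond_connected : r < n -> connected_in (variable_graph r n) beyond.
Proof.
move=> rn; have [n2|n3] := leqP n 2.
  have inB u : u \in beyond -> u = tvar l0 i1.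
    rewrite inE; case: u => [j /eqP jE|[l i] /eqP->]; first by have := ltn_ord j; lia.
    by congr (inr (_, _)); apply: val_inj => /=; have := ltn_ord l; have := ltn_ord l0; lia.
  by move=> u v /inB-> /inB->; apply: connect0.
apply: (@connected_in_hub _ _ _ (xvar r (Ordinal n3))) => -[j|[l i]] uB.
  rewrite (_ : j = Ordinal n3) ?connect0 //.
  by apply: val_inj; move: uB; rewrite inE => /eqP.
apply/connect1/and3P; split; [|by rewrite inE|by []].
rewrite adj_sym variable_graph_tx; move: uB; rewrite inE => /eqP->.
by rewrite i1E orbT.
Qed.

(** [xvar r i1] is adjacent to the first two vertices of every row, and each other member contains
    one of these. A full row is adjacent to every x variable. Each kind is compared with all others
    in turn, earlier pairs following by symmetry. *)
Lemma probe_bramble : bramble (variable_graph r n) probe.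
Proof.
split.
  move=> _ [||l j|l|rn]; [exact: connected_in1|exact: row_connected| | |exact: beyond_connected].
    apply: connected_inU1 (@row_connected _) (@mem_row l j) _.
    by rewrite adj_sym variable_graph_tx eqxx.
  apply: connected_inU1 (@connected_in1 _ _ (tvar l i0)) (set11 (tvar l i0)) _.
  by rewrite adj_sym variable_graph_tx eqxx.
have hub B : probe B -> touching (variable_graph r n) [set xvar r i1] B.
  have tB (l : 'I_r) (i : 'I_n) (B' : {set var r n}) : tvar l i \in B' -> (i == i0) || (i == i1) ->
      touching (variable_graph r n) [set xvar r i1] B'.
    move=> tB' ii; exists (xvar r i1), (tvar l i); rewrite set11 tB' adj_sym; split=> //.
    by rewrite variable_graph_tx; case/orP: ii => /eqP->; rewrite ?eqxx // i0E i1E orbT.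
  case=> [||l j|l|_].
  - by exists (xvar r i1), (xvar r i1); rewrite set11 eqxx.
  - by apply: (tB l0 i0); rewrite ?mem_row ?eqxx.
  - by apply: (tB l i0); rewrite ?eqxx // inE mem_row orbT.
  - by apply: (tB l i0); rewrite ?eqxx // !inE eqxx orbT.
  - by apply: (tB l0 i1); rewrite ?eqxx ?orbT // inE /= eqxx.
have bey l : tvar l i1 \in beyond by rewrite inE /= eqxx.
have cross B l j : probe B -> touching (variable_graph r n) (xvar r j |: row l) B.
  have lA : row l \subset xvar r j |: row l by exact: subsetUr.
  case=> [||l' j'|l'|_].
  - by apply: row_touching lA _; left; exists i1; rewrite set11.
  - by apply/touching_sym/(row_touching (subxx _)); left; exists j; rewrite setU11.
  - by apply: row_touching lA _; left; exists j'; rewrite setU11.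
  - by apply: row_touching lA _; left; exists i0; rewrite !inE eqxx.
  - by apply: row_touching lA _; right; exists i1.
have row_ B : probe B -> touching (variable_graph r n) (row l0) B.
  case=> [||l j|l|_]; try by apply/touching_sym; first [apply: hub|apply: cross]; constructor.
  - by apply: row_touching (subxx _) _; right; exists i0; rewrite mem_row.
  - by apply: row_touching (subxx _) _; left; exists i0; rewrite !inE eqxx.
  - by apply: row_touching (subxx _) _; right; exists i1.
have corner B l : probe B -> touching (variable_graph r n) [set xvar r i0; tvar l i0] B.
  case=> [||l' j|l'|_];
    try by apply/touching_sym; first [apply: hub|apply: cross|apply: row_]; constructor.
  - by exists (xvar r i0), (xvar r i0); rewrite !inE !eqxx.
  (* A corner meets [beyond] only through the first edge of its row. *)
  - exists (tvar l i0), (tvar l i1); rewrite bey !inE eqxx orbT; split=> //.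
    by rewrite variable_graph_tt eqxx i0E i1E orbT.
move=> _ B [||l j|l|rn] PB; [exact: hub|exact: row_|exact: cross|exact: corner|].
case: PB => [||l j|l|_];
  try by apply/touching_sym;
    first [apply: hub|apply: cross|apply: row_|apply: corner]; constructor.
by exists (tvar l0 i1), (tvar l0 i1); rewrite bey eqxx.
Qed.

Lemma probe_missed (X : {set var r n}) :
  #|X| <= minn n r.+1 -> exists2 A, probe A & [disjoint X & A].
Proof.
rewrite leq_min => /andP[Xn Xr].
have [x1X|x1X] := boolP (xvar r i1 \in X); last first.
  by exists [set xvar r i1]; [constructor|rewrite disjoint_sym disjoints1].
(* If [X] contains all [n] x variables, its size leaves room for nothing else and every row is
   missed. *)
have [/forallP allx|/forallPn[j xjX]] := boolP [forall j, xvar r j \in X].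
  have <- : [set xvar r j | j : 'I_n] = X.
    apply/eqP; rewrite eqEcard; apply/andP; split.
      by apply/subsetP=> _ /imsetP[j _ ->].
    by rewrite card_imset ?card_ord // => a b [].
  exists (row l0); first by constructor.
  rewrite disjoint_subset; apply/subsetP=> _ /imsetP[j _ ->].
  by rewrite inE; apply/imsetP=> -[].
have [/existsP[l Xl]|] := boolP [exists l, [disjoint X & row l]].
  exists (xvar r j |: row l); first by constructor.
  apply: contraT => /meetP[v vX /setU1P[ve|vl]]; first by rewrite -ve vX in xjX.
  by move: Xl; apply: contraLR => _; apply/meetP; exists v.
move=> /existsPn hit.
have /choice[f fX] : forall l, exists i, tvar l i \in X.
  by move=> l; have /meetP[v vX /imsetP[i _ vE]] := hit l; exists i; rewrite -vE.
pose Y := xvar r i1 |: [set tvar l (f l) | l : 'I_r].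
have cardY : #|Y| = r.+1.
  rewrite cardsU1 card_imset ?card_ord; last by move=> a b [].
  by rewrite (_ : _ \in _ = false) //; apply/imsetP=> -[].
have YX : Y = X.
  apply/eqP; rewrite eqEcard cardY Xr andbT; apply/subsetP=> v.
  by case/setU1P=> [->|/imsetP[l _ ->]].
(* The [r + 1] vertices found exhaust [X], whose size is at most [n]; this makes [beyond]
   available. *)
have rn : r < n by rewrite -cardY YX.
have xY i : (xvar r i \in Y) = (i == i1).
  rewrite !inE; case: imsetP => [[]//|_]; rewrite orbF.
  by apply/eqP/eqP => [[]|->].
have tY l i : tvar l i \in Y -> i = f l.
  by rewrite !inE => /imsetP[l' _ [-> ->]].
have [/forallP f0|/forallPn[l fl]] := boolP [forall l, f l == i0].
  exists beyond; first by constructor.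
  apply: contraT => /meetP[v]; rewrite -YX => vY; rewrite inE; case: v vY => [k|[l i]] vY /eqP.
    by have := xY k; rewrite vY => /esym/eqP->; rewrite i1E.
  by rewrite (tY _ _ vY) (eqP (f0 l)) => /(congr1 val); rewrite /= i0E i1E.
exists [set xvar r i0; tvar l i0]; first by constructor.
apply: contraT => /meetP[v]; rewrite -YX => vY /set2P[] ve; rewrite {}ve in vY.
  by rewrite xY -val_eqE /= i0E i1E in vY.
by rewrite -(tY _ _ vY) eqxx in fl.
Qed.

End GridBramble.

(** * The two bounds combined *)

Lemma variable_graph_treewidth_ge (r n : nat) :
  0 < r -> 0 < n -> minn n r.+1 <= treewidth (variable_graph r n).
Proof.
move=> r0 n0; have [n1|n2] := leqP n 1.
  apply: (@leq_trans 1); first by rewrite geq_min n1.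
  apply: (@treewidth_gt0 _ _ (tvar (Ordinal r0) (Ordinal n0)) (xvar r (Ordinal n0))).
  by rewrite variable_graph_tx eqxx.
apply: leq_treewidth
  (@probe_bramble _ _ (Ordinal r0) (Ordinal n0) (Ordinal n2) erefl erefl) _.
exact: probe_missed.
Qed.

Theorem theorem3p3 (r n : nat) (r_ge1 : 1 <= r) (n_ge1 : 1 <= n) :
  treewidth (variable_graph r n) = minn n r.+1 /\
  (r.+1 <= n ->
   exists H : sgraph (var r n),
     chordal_extension (variable_graph r n) H /\ clique_number H <= r.+2).
Proof.
split=> [|_].
  apply/eqP; rewrite eqn_leq variable_graph_treewidth_ge // andbT leq_min.
  apply/andP; split.
    exact: treewidth_le (spider_tree_decomposition _ _) (@spider_bag_card _ _).
  (* The sweep has one position per constraint. *)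
  have lt v : @sweep_lo r n v < n * r.
    by case: v => [i|[l i]] /=; have := ltn_ord i; try have := ltn_ord l; nia.
  have [|T [E [f td]]] := interval_tree_decomposition (@sweep_lo_hi r n r_ge1) lt _
    (@sweep_edge r n r_ge1).
    by rewrite muln_gt0 n_ge1.
  by apply: treewidth_le td _ => t; apply: sweep_bag_card.
exists (interval_graph (@sweep_lo r n) (@sweep_hi r n)); split.
  by split; [exact: sweep_edge|exact: interval_graph_chordal].
by apply: interval_clique_number => [v|p]; [exact: sweep_lo_hi|exact: sweep_bag_card].
Qed.
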